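(* Let $p$ be an odd prime, $n\ge2$, $G=G_{p^{n+1}}=\langle a,b\mid a^{p^n}=1,\ b^p=1,\ b^{-1}ab=a^{p^{n-1}+1}\rangle$, and let $q$ be a prime power with $\gcd(q,p)=1$. Then $$\mathbb{F}_qG\cong\begin{cases}\mathbb{F}_q\ \oplus\ \dfrac{\phi(p)}{o_p(q)}\,\mathbb{F}_{q^{o_p(q)}}\ \oplus\ \displaystyle\bigoplus_{j=1}^{n-1}p\,\dfrac{\phi(p^j)}{o_{p^j}(q)}\,\mathbb{F}_{q^{o_{p^j}(q)}}\ \oplus\ \dfrac{\phi(p^n)}{o_{p^n}(q)}\,M_p\!\left(\mathbb{F}_{q^{o_{p^n}(q)/p}}\right), & \text{if }1+p^{n-1}\in\langle q\rangle\bmod p^n,\\[4mm] \mathbb{F}_q\ \oplus\ \dfrac{\phi(p)}{o_p(q)}\,\mathbb{F}_{q^{o_p(q)}}\ \oplus\ \displaystyle\bigoplus_{j=1}^{n-1}p\,\dfrac{\phi(p^j)}{o_{p^j}(q)}\,\mathbb{F}_{q^{o_{p^j}(q)}}\ \oplus\ \dfrac{\phi(p^n)}{p\,o_{p^n}(q)}\,M_p\!\left(\mathbb{F}_{q^{o_{p^n}(q)}}\right), & \text{otherwise.}\end{cases}$$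
   Context: $\mathbb{F}_{q}$ is the field with $q$ elements; $\phi$ is Euler's totient; $o_m(q)$ is the multiplicative order of $q$ modulo $m$; $\langle q\rangle\bmod p^n$ is the subgroup of $(\mathbb{Z}/p^n)^*$ generated by $q$. $M_p(F)$ is the algebra of $p\times p$ matrices over $F$, and for a positive integer $s$ and an algebra $A$, $s\,A$ denotes the direct sum of $s$ copies of $A$. *)

(* Defs.v *)
From HB Require Import structures.
From mathcomp Require Import all_boot all_fingroup all_algebra all_solvable.
From mathcomp Require Import all_field.

Set Implicit Arguments.
Unset Strict Implicit.
Unset Printing Implicit Defensive.

Import GRing.Theory.
Local Open Scope ring_scope.

(* The group algebra R[gT]. This is an alias of {ffun gT -> R}, because the   *)
(* ring structure of the latter is pointwise whereas here it is convolution.  *)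
Definition group_alg (R : comNzRingType) (gT : finGroupType) : Type :=
  {ffun gT -> R}.

Section GroupAlgebra.
Variables (R : comNzRingType) (gT : finGroupType).
Local Notation RG := (group_alg R gT).
Implicit Types (u v w : RG) (x y : gT) (c : R).

HB.instance Definition _ := GRing.Lmodule.copy RG {ffun gT -> R^o}.

Definition galg_delta x : RG := [ffun y => (y == x)%:R].

Definition galg_mul u v : RG := [ffun x => \sum_y u y * v (y^-1 * x)%g].

Lemma galgD u v x : (u + v) x = u x + v x.
Proof. by rewrite ffunE. Qed.

Lemma galgZ c u x : (c *: u) x = c * u x.
Proof. by rewrite ffunE. Qed.

Fact galg_mulA : associative galg_mul.
Proof.
move=> u v w; apply/ffunP=> x; rewrite !ffunE.
under eq_bigr do rewrite ffunE big_distrr /=.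
under [RHS]eq_bigr do rewrite ffunE big_distrl /=.
rewrite [RHS]exchange_big /=; apply: eq_bigr => y _.
rewrite (reindex_inj (mulgI y^-1%g)) /=; apply: eq_bigr => z _.
by rewrite mulrA invMg invgK -mulgA mulKVg.
Qed.

Fact galg_mul1l : left_id (galg_delta 1) galg_mul.
Proof.
move=> u; apply/ffunP=> x; rewrite ffunE (bigD1 1%g) //= big1 => [|y /negPf ny].
  by rewrite !ffunE eqxx mul1r invg1 mul1g addr0.
by rewrite !ffunE ny mul0r.
Qed.

Fact galg_mul1r : right_id (galg_delta 1) galg_mul.
Proof.
move=> u; apply/ffunP=> x; rewrite ffunE (bigD1 x) //= big1 => [|y nyx].
  by rewrite !ffunE mulVg eqxx mulr1 addr0.
by rewrite !ffunE -eq_mulVg1 (negPf nyx) mulr0.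
Qed.

Fact galg_mulDl : left_distributive galg_mul +%R.
Proof.
move=> u v w; apply/ffunP=> x; rewrite !ffunE -big_split /=.
by apply: eq_bigr => y _; rewrite ffunE mulrDl.
Qed.

Fact galg_mulDr : right_distributive galg_mul +%R.
Proof.
move=> u v w; apply/ffunP=> x; rewrite !ffunE -big_split /=.
by apply: eq_bigr => y _; rewrite ffunE mulrDr.
Qed.

Fact galg_1neq0 : galg_delta 1 != 0 :> RG.
Proof.
by apply/eqP=> /ffunP/(_ 1%g)/eqP; rewrite !ffunE eqxx oner_eq0.
Qed.

HB.instance Definition _ := GRing.Zmodule_isNzRing.Build RG
  galg_mulA galg_mul1l galg_mul1r galg_mulDl galg_mulDr galg_1neq0.

Fact galg_scaleAl c u v : c *: (u * v) = (c *: u) * v.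
Proof.
apply/ffunP=> x; rewrite !ffunE scaler_sumr.
by apply: eq_bigr => y _; rewrite ffunE; exact: mulrA.
Qed.

HB.instance Definition _ := GRing.Lmodule_isLalgebra.Build R RG galg_scaleAl.

Fact galg_scaleAr c u v : c *: (u * v) = u * (c *: v).
Proof.
apply/ffunP=> x; rewrite !ffunE scaler_sumr.
by apply: eq_bigr => y _; rewrite ffunE; exact: mulrCA.
Qed.

HB.instance Definition _ := GRing.Lalgebra_isAlgebra.Build R RG galg_scaleAr.

Lemma galg_deltaM x y : galg_delta x * galg_delta y = galg_delta (x * y)%g.
Proof.
apply/ffunP=> z; rewrite ffunE (bigD1 x) //= big1 => [|t /negPf ntx].
  by rewrite !ffunE eqxx mul1r addr0 -(inj_eq (mulgI x)) mulKVg.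
by rewrite !ffunE ntx mul0r.
Qed.

Lemma galg_sum_delta u : u = \sum_x u x *: galg_delta x.
Proof.
apply/ffunP=> y; rewrite sum_ffunE (bigD1 y) //= big1 => [|x nxy].
  by rewrite !ffunE eqxx addr0 [RHS]mulr1.
by rewrite !ffunE eq_sym (negPf nxy) [LHS]mulr0.
Qed.

End GroupAlgebra.

(* The algebra of p x p matrices over L, as an algebra over the base field F  *)
(* instead of over L. The library only has the nontrivial ring structure on   *)
(* matrices of successor size, hence the index p.-1.+1 (as in 'GL_p[L]),      *)
(* which is p as soon as 0 < p.                                               *)
Definition mat_alg (F : fieldType) (L : fieldExtType F) (p : nat) : Type :=
  'M[L]_p.-1.+1.

Section MatrixAlgebraOverBase.
Variables (F : fieldType) (L : fieldExtType F) (p : nat).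
Local Notation ML := (mat_alg L p).
Implicit Types (c d : F) (A B : ML).

HB.instance Definition _ := GRing.NzRing.copy ML 'M[L]_p.-1.+1.

Definition mat_scale c A : ML := c%:A *: (A : 'M[L]_p.-1.+1).

Fact mat_scaleA c d A : mat_scale c (mat_scale d A) = mat_scale (c * d) A.
Proof. by rewrite /mat_scale scalerA -scalerAl mul1r scalerA. Qed.

Fact mat_scale1 : left_id 1 mat_scale.
Proof. by move=> A; rewrite /mat_scale !scale1r. Qed.

Fact mat_scaleDr : right_distributive mat_scale +%R.
Proof. by move=> c A B; exact: scalerDr. Qed.

Fact mat_scaleDl A : {morph mat_scale^~ A : c d / c + d}.
Proof. by move=> c d; rewrite /mat_scale !scalerDl. Qed.

HB.instance Definition _ := GRing.Zmodule_isLmodule.Build F ML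
  mat_scaleA mat_scale1 mat_scaleDr mat_scaleDl.

Fact mat_scaleAl c A B : c *: (A * B) = (c *: A) * B.
Proof. exact: (@scalerAl L 'M[L]_p.-1.+1). Qed.

HB.instance Definition _ := GRing.Lmodule_isLalgebra.Build F ML mat_scaleAl.

Fact mat_scaleAr c A B : c *: (A * B) = A * (c *: B).
Proof. exact: (@scalerAr L 'M[L]_p.-1.+1). Qed.

HB.instance Definition _ := GRing.Lalgebra_isAlgebra.Build F ML mat_scaleAr.

End MatrixAlgebraOverBase.

Fixpoint direct_sum (F : fieldType) (A : algType F) (s : seq (algType F)) :
    algType F :=
  if s is B :: s' then (A * direct_sum B s')%type else A.

Definition copies (F : fieldType) (s : nat) (A : algType F) :
  seq (algType F) := nseq s A.

Definition alg_iso (F : fieldType) (A B : algType F) : Prop :=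
  exists f : {lrmorphism A -> B}, bijective f.

(* The class of k in the unit group of Z/m; the default value 1 is taken when *)
(* k is not coprime to m. Only meaningful for 1 < m, as 'Z_m is Z/m then.     *)
Definition unit_mod (m k : nat) : {unit 'Z_m} := insubd (1%g : {unit 'Z_m}) k%:R.

Lemma unit_modE (m k : nat) :
  (1 < m)%N -> coprime m k -> val (unit_mod m k) = k%:R.
Proof. by move=> m_gt1 cmk; rewrite insubdK // [_ \in _]unitZpE. Qed.

Definition mult_order (m k : nat) : nat := #[unit_mod m k]%g.

(* Extensions of F of every degree exist; those of degree d are the models of *)
(* the field with #|F| ^ d elements.                                          *)
Lemma finField_extension_exists (F : finFieldType) (d : nat) :
  (0 < d)%N -> exists L : fieldExtType F, \dim {:L} = d.
Proof.
move=> d_gt0; pose m := (#|F| ^ d)%N.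
have m_gt1: (m > 1)%N by rewrite -(exp1n d) ltn_exp2r ?finNzRing_gt1.
have m_gt0 := ltnW m_gt1; have m1_gt0: (m.-1 > 0)%N by rewrite -ltnS prednK.
pose q (R : nzRingType) : {poly R} := 'X^m - 'X.
have Dq R: q R = ('X^(m.-1) - 1) * ('X - 0).
  by rewrite subr0 mulrBl mul1r -exprSr prednK.
have /FinSplittingFieldFor[/= L splitLq]: q F != 0.
  by rewrite Dq monic_neq0 ?rpredM ?monicXsubC ?monicXnsubC.
exists L.
rewrite rmorphB rmorphXn /= map_polyX -/(q L) in splitLq.
have [a _ Da] := finField_galois_generator (sub1v {:L}%AS).
pose Em := fixedSpace (a ^+ d)%g; rewrite /= dimv1 expn1 in Da.
have{splitLq} [zs DqL defL] := splitLq.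
have mL0: m%:R = 0 :> L.
  have [p pr_p pF] := finPcharP F.
  have pL : p \in [pchar L] by rewrite pchar_lalg.
  move: m_gt1; rewrite /m (card_pprimeChar pF) -expnM.
  by case: (_ * d)%N => // e _; rewrite expnS natrM (pcharf0 pL) mul0r.
have Uzs: uniq zs.
  rewrite -separable_prod_XsubC -(eqp_separable DqL) Dq separable_root andbC.
  rewrite /root !hornerE subr_eq0 eq_sym expr0n gtn_eqF ?oner_eq0 //=.
  rewrite cyclotomic.separable_Xn_sub_1 // -subn1 natrB // subr_eq0.
  by rewrite mL0 eq_sym oner_eq0.
have in_zs: zs =i Em.
  move=> z; rewrite -root_prod_XsubC -(eqp_root DqL) (sameP fixedSpaceP eqP).
  rewrite /root !hornerE subr_eq0 /= /m; congr (_ == z).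
  elim: (d) => [|i IHi]; first by rewrite gal_id.
  by rewrite expgSr expnSr exprM IHi galM ?Da ?memvf.
have defEm: Em = {:L}%VS.
  apply/eqP; rewrite eqEsubv subvf -defL -[Em]subfield_closed agenvS //.
  by rewrite subv_add sub1v; apply/span_subvP=> z; rewrite in_zs.
have szs: size zs = m.
  apply: succn_inj; rewrite -(size_prod_XsubC _ id) -(eqp_size DqL).
  by rewrite size_polyDl size_polyXn // size_polyN size_polyX.
pose finL := FinFieldExtType L.
have: #|finL| = m.
  have /eq_card->: finL =i zs by move=> z; rewrite in_zs defEm memvf.
  by rewrite (card_uniqP _).
rewrite -(@card_vspacef F finL (Vector.class L)) card_vspace => /eqP.
by rewrite eqn_exp2l ?finNzRing_gt1 // => /eqP.
Qed.

(* Main.v *)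
Require Import Defs.
From HB Require Import structures.
From mathcomp Require Import all_boot all_fingroup all_algebra all_solvable.
From mathcomp Require Import all_field.
From mathcomp Require Import ring zify.

(* Every element of G is b^k a^i for unique k < p and i < p^n, so a           *)
(* homomorphism out of F[G] is given by images of a and b satisfying the      *)
(* relations. Put N = p^(n-1). The linear characters send a to a root of      *)
(* unity x of order dividing N and b to a p-th root of unity; up to Frobenius *)
(* conjugacy, those with x of order m = p^j > 1 are a |-> x, b |-> x^(m/p t)  *)
(* with t < p. The other components are matrix algebras over the single field *)
(* F(w), with w a primitive N-th root of unity: a acts as the companion       *)
(* matrix of X^p - w and b as the diagonal matrix of the powers of w^(N/p).   *)
(* The two cases of the theorem only differ in whether the order of q modulo  *)
(* p^n is p times its order modulo N or equal to it. One component is taken   *)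
(* for each coset of <q> in the units of Z/m, that is for each Frobenius      *)
(* orbit of primitive m-th roots of unity. Fourier inversion shows that the   *)
(* resulting map from F[G] to the direct sum is injective, and both sides     *)
(* have the same finite cardinality.                                          *)

Set Implicit Arguments.
Unset Strict Implicit.
Unset Printing Implicit Defensive.

Import GRing.Theory.
Local Open Scope ring_scope.

(** Write N = p^(n-1). Both cases are readings of one decomposition, [group_alg_decomposition],
    whose noncommutative part is phi(N)/o_N(q) copies of M_p over the extension of degree o_N(q).
    Indeed phi(p^n) = p phi(N), while o_{p^n}(q) is p o_N(q) or o_N(q) according to whether 1 + N
    lies in the subgroup generated by q ([mult_order_mem], [mult_order_notin]).

    The decomposition is proved by an explicit map. By [modular_group_normal_form] an element of
    F[G] is a table of coefficients c(k,i) of b^k a^i. The value of a character, or an entry of a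
    matrix representation, is a polynomial over F in these coefficients evaluated at a root of
    unity, so its vanishing at one root in each Frobenius orbit gives its vanishing at all primitive
    roots of that order, in every extension ([conjugacy_representatives]). All the resulting
    equations then live in one field, where [fourier_eq0] gives c = 0. Surjectivity is a count: 1 +
    phi(p) + p (phi(p) + ... + phi(N)) + p^2 phi(N) = p^(n+1). *)

(** * Homomorphisms out of a group algebra *)

Lemma lrmorphism_exists (R : nzRingType) (A B : lalgType R) (f : A -> B) :
  linear f -> monoid_morphism f -> exists g : {lrmorphism A -> B}, g =1 f.
Proof.
move=> f_lin f_mon.
pose fl := GRing.isLinear.Build R A B _ f f_lin.
pose fm := GRing.isMonoidMorphism.Build A B f f_mon.
pose g : {lrmorphism A -> B} := HB.pack f fl fm.
by exists g.
Qed.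

Lemma galg_lift (R : comNzRingType) (gT : finGroupType) (B : algType R)
    (rho : gT -> B) :
  rho 1%g = 1 -> {morph rho : x y / (x * y)%g >-> x * y} ->
  exists f : {lrmorphism group_alg R gT -> B},
    forall u, f u = \sum_x u x *: rho x.
Proof.
move=> rho1 rhoM; pose f (u : group_alg R gT) := \sum_x u x *: rho x.
have f_lin : linear f.
  move=> c u v; rewrite /f scaler_sumr -big_split; apply: eq_bigr => x _ /=.
  by rewrite galgD galgZ scalerDl scalerA.
have f_mon : monoid_morphism f.
  split=> [|u v]; rewrite /f.
    rewrite (bigD1 1%g) //= big1 => [|x /negPf nx1];
      rewrite ffunE ?nx1 ?scale0r //.
    by rewrite eqxx rho1 scale1r addr0.
  under eq_bigr do rewrite ffunE scaler_suml.
  rewrite exchange_big big_distrl; apply: eq_bigr => y _ /=.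
  rewrite (reindex_inj (mulgI y)) big_distrr; apply: eq_bigr => x _ /=.
  by rewrite mulKg rhoM -scalerAr -scalerAl scalerA mulrC.
by have [g Eg] := lrmorphism_exists f_lin f_mon; exists g => u; rewrite Eg.
Qed.

(** * Separating families of homomorphisms *)

(* Homomorphisms from A to the members of s, such that any element of A       *)
(* killed by all of them satisfies P.                                         *)
Fixpoint detects (F : fieldType) (A : algType F) (s : seq (algType F))
    (P : A -> Prop) : Prop :=
  if s is B :: s' then
    exists g : {lrmorphism A -> B}, detects s' (fun u => g u = 0 -> P u)
  else forall u, P u.

Lemma detects_weaken (F : fieldType) (A : algType F) (s : seq (algType F))
    (P Q : A -> Prop) :
  (forall u, P u -> Q u) -> detects s P -> detects s Q.
Proof.
elim: s P Q => [|B s IHs] P Q PQ /=; first by move=> HP u; apply/PQ/HP.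
by case=> g Hg; exists g; apply: IHs Hg => u Pu /Pu/PQ.
Qed.

Lemma detects_cat (F : fieldType) (A : algType F) (s1 s2 : seq (algType F))
    (P1 P2 : A -> Prop) :
  detects s1 P1 -> detects s2 P2 ->
  detects (s1 ++ s2) (fun u => P1 u /\ P2 u).
Proof.
elim: s1 P1 => [|B s1 IHs] P1 /= => [P1T|[g Hg] H2].
  by apply: detects_weaken.
by exists g; apply: detects_weaken (IHs _ Hg H2) => u [P1u P2u] /P1u.
Qed.

Lemma detects_flatten (F : fieldType) (A : algType F) (I : eqType) (r : seq I)
    (s : I -> seq (algType F)) (P : I -> A -> Prop) :
  (forall i, i \in r -> detects (s i) (P i)) ->
  detects (flatten [seq s i | i <- r]) (fun u => forall i, i \in r -> P i u).
Proof.
elim: r => [|i r IHr] Hr /=; first by [].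
have := detects_cat (Hr i (mem_head _ _))
  (IHr (fun k kr => Hr k (mem_behead (s := i :: r) kr))).
apply: detects_weaken => u [Pi Pr] k.
by rewrite inE => /predU1P[->|/Pr].
Qed.

(** Indexing the copies by a set lets them be labelled by Frobenius orbits. *)
Lemma detects_copies (F : fieldType) (A B : algType F) (X : finType)
    (S : {set X}) (g : X -> {lrmorphism A -> B}) :
  detects (copies #|S| B) (fun u => forall x, x \in S -> g x u = 0).
Proof.
suff: detects (nseq (size (enum S)) B)
    (fun u => forall x, x \in enum S -> g x u = 0).
  rewrite -cardE; apply: detects_weaken => u Hu x Sx.
  by apply: Hu; rewrite mem_enum.
elim: (enum S) => [|x s IHs] //=; exists (g x).
apply: detects_weaken IHs => u Hu gx y.
by rewrite inE => /predU1P[->|/Hu].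
Qed.

(** A [direct_sum] always has a head summand, which [g] fills; in the application [g] is the trivial
    character. *)
Lemma detects_direct_sum (F : fieldType) (A B : algType F)
    (s : seq (algType F)) (P : A -> Prop) (g : {lrmorphism A -> B}) :
  detects s P ->
  exists f : {lrmorphism A -> direct_sum B s},
    forall u, f u = 0 -> g u = 0 /\ P u.
Proof.
elim: s B P g => [|C s IHs] B P g /= => [HP|[h Hh]].
  by exists g => u gu0; split.
have [f Hf] := IHs _ _ h Hh.
pose gf u : (B * direct_sum C s)%type := (g u, f u).
have gf_lin : linear gf.
  by move=> c u v; rewrite /gf !linearP.
have gf_mon : monoid_morphism gf.
  by split=> [|u v]; rewrite /gf ?rmorph1 ?rmorphM.
have [k Ek] := lrmorphism_exists gf_lin gf_mon.
by exists k => u; rewrite Ek => -[gu0 /Hf[hu0 /(_ hu0)]].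
Qed.

(** * Counting elements *)

(** The summands are known only as algebras, without a [finType] structure, so finiteness is carried
    by a bijection. *)
Definition has_card (B : Type) (c : nat) : Prop :=
  exists (T : finType) (h : T -> B), bijective h /\ #|T| = c.

Lemma has_card_inj_bij (A B : Type) c (f : A -> B) :
  has_card A c -> has_card B c -> injective f -> bijective f.
Proof.
move=> [S [h [[h' hK h'K] cS]]] [T [k [[k' kK k'K] cT]]] f_inj.
have g_inj : injective (k' \o f \o h).
  by apply: inj_comp (can_inj hK); apply: inj_comp f_inj; apply: can_inj k'K.
have [|g' gK g'K] := inj_card_bij g_inj; first by rewrite cT cS.
exists (h \o g' \o k') => x /=.
  by rewrite -{1}[x]h'K (gK (h' x)).
by rewrite (can_inj k'K (g'K (k' x))).
Qed.

Lemma has_card_prod (A B : Type) (c d : nat) :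
  has_card A c -> has_card B d -> has_card (A * B) (c * d).
Proof.
move=> [S [h [[h' hK h'K] <-]]] [T [k [[k' kK k'K] <-]]].
exists (S * T)%type, (fun x => (h x.1, k x.2)); rewrite card_prod; split=> //.
by exists (fun y => (h' y.1, k' y.2)) => -[x y] /=; rewrite ?kK ?hK ?k'K ?h'K.
Qed.

(** Ending in the one-element type makes cardinality multiplicative under concatenation, empty lists
    included. *)
Fixpoint prod_all (F : fieldType) (s : seq (algType F)) : Type :=
  if s is B :: s' then (B * prod_all s')%type else unit.

Lemma has_card_unit : has_card unit 1.
Proof. by exists unit, id; split; [exists id|rewrite card_unit]. Qed.

Lemma has_card_bij (A B : Type) (c : nat) (f : A -> B) :
  bijective f -> has_card A c -> has_card B c.
Proof.
move=> bij_f [T [h [bij_h cT]]]; exists T, (f \o h).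
by split=> //; apply: bij_comp.
Qed.

Lemma direct_sum_bij (F : fieldType) (B : algType F) (s : seq (algType F)) :
  exists h : B * prod_all s -> direct_sum B s, bijective h.
Proof.
elim: s B => [|C s IHs] B /=.
  by exists fst, (fun x => (x, tt)) => [[? []]|].
have [h [h' hK h'K]] := IHs C.
exists (fun x => (x.1, h x.2)), (fun y => (y.1, h' y.2)) => -[x y] /=.
  by rewrite hK.
by rewrite h'K.
Qed.

Lemma has_card_cat (F : fieldType) (c d : nat) (s t : seq (algType F)) :
  has_card (prod_all s) c -> has_card (prod_all t) d ->
  has_card (prod_all (s ++ t)) (c * d).
Proof.
move=> cs ct.
suff [h bij_h]: exists h : prod_all s * prod_all t -> prod_all (s ++ t),
    bijective h.
  exact/(has_card_bij bij_h)/has_card_prod.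
elim: s {cs} => [|B s [h [h' hK h'K]]] /=.
  by exists snd, (fun x => (tt, x)) => // -[[]].
exists (fun x => (x.1.1, h (x.1.2, x.2))),
  (fun y => (y.1, (h' y.2).1, (h' y.2).2)).
  by case=> [[x y] z] /=; rewrite hK.
by case=> x y /=; rewrite -surjective_pairing h'K.
Qed.

Lemma has_card_copies (F : fieldType) (c k : nat) (B : algType F) :
  has_card B c -> has_card (prod_all (copies k B)) (c ^ k).
Proof.
move=> cB; elim: k => [|k IHk]; first exact: has_card_unit.
by rewrite expnS; apply: has_card_prod.
Qed.

Lemma has_card_flatten (F : fieldType) (I : eqType) (r : seq I) (q : nat)
    (d : I -> nat) (s : I -> seq (algType F)) :
  (forall i, i \in r -> has_card (prod_all (s i)) (q ^ d i)) ->
  has_card (prod_all (flatten [seq s i | i <- r])) (q ^ \sum_(i <- r) d i).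
Proof.
elim: r => [|i r IHr] Hr /=; first by rewrite big_nil; apply: has_card_unit.
rewrite big_cons expnD; apply: has_card_cat; first exact/Hr/mem_head.
by apply: IHr => k kr; apply/Hr/mem_behead.
Qed.

Lemma card_FinFieldExt (F : finFieldType) (L : fieldExtType F) :
  #|FinFieldExtType L| = (#|F| ^ \dim {:L})%N.
Proof.
by rewrite -(@card_vspacef F (FinFieldExtType L) (Vector.class L)) card_vspace.
Qed.

Lemma has_card_fieldExt (F : finFieldType) (L : fieldExtType F) :
  has_card L (#|F| ^ \dim {:L}).
Proof.
by exists (FinFieldExtType L), id; split; [exists id | apply: card_FinFieldExt].
Qed.

Lemma has_card_mat_alg (F : finFieldType) (L : fieldExtType F) p :
  (0 < p)%N -> has_card (mat_alg L p) (#|F| ^ (\dim {:L} * p ^ 2)).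
Proof.
move=> p_gt0; have [T [h [[h' hK h'K] cT]]] := has_card_fieldExt L.
exists 'M[T]_p.-1.+1, (map_mx h : 'M[T]_p.-1.+1 -> 'M[L]_p.-1.+1); split.
  by exists (map_mx h') => A; apply/matrixP=> i j; rewrite !mxE.
by rewrite card_mx cT -expnM prednK // mulnn.
Qed.

Lemma has_card_group_alg (F : finFieldType) (gT : finGroupType) :
  has_card (group_alg F gT) (#|F| ^ #|gT|).
Proof. by exists {ffun gT -> F}, id; split; [exists id|rewrite card_ffun]. Qed.

(** * Multiplicative orders modulo m *)

Lemma unit_modX (m k i : nat) :
  (1 < m)%N -> coprime m k -> (unit_mod m k ^+ i)%g = unit_mod m (k ^ i).
Proof.
move=> m_gt1 cmk; apply: val_inj; rewrite unit_modE ?coprimeXr // natrX.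
by rewrite -(unit_modE m_gt1 cmk) FinRing.val_unitX.
Qed.

Lemma eq_unit_mod (m j k : nat) : (1 < m)%N -> coprime m j -> coprime m k ->
  (unit_mod m j == unit_mod m k) = (j == k %[mod m]).
Proof.
move=> m_gt1 cmj cmk; rewrite -val_eqE !unit_modE // -val_eqE /=.
by rewrite !val_Zp_nat.
Qed.

Lemma unit_mod1 (m : nat) : (1 < m)%N -> unit_mod m 1 = 1%g.
Proof. by move=> m_gt1; apply: val_inj; rewrite unit_modE ?coprimen1. Qed.

Lemma dvdn_mult_order (m k i : nat) : (1 < m)%N -> coprime m k ->
  (mult_order m k %| i)%N = (k ^ i == 1 %[mod m])%N.
Proof.
move=> m_gt1 cmk; rewrite order_dvdn unit_modX // -(unit_mod1 m_gt1).
by rewrite eq_unit_mod ?coprimen1 ?coprimeXr.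
Qed.

Lemma mult_order_dvd_totient (m k : nat) : (1 < m)%N ->
  (mult_order m k %| totient m)%N.
Proof.
move=> m_gt1; rewrite -card_units_Zp ?(ltnW m_gt1) //.
by apply: order_dvdG; rewrite inE.
Qed.

(** Used with [k] = q: Frobenius multiplies the exponents of a primitive root by q, so these cosets
    label its orbits. *)
Lemma totient_div_mult_order (m k : nat) : (1 < m)%N ->
  (totient m %/ mult_order m k)%N
    = #|rcosets <[unit_mod m k]> [set: {unit 'Z_m}]|.
Proof.
by move=> m_gt1; rewrite -card_units_Zp ?(ltnW m_gt1) // divgS ?subsetT.
Qed.

(** * Primitive roots of unity and Frobenius orbits *)

Section RootsOfUnity.

Variables (F : finFieldType).
Local Notation q := #|F|.

(** The nonzero elements of a field with Q elements are Q - 1 distinct roots of X^(Q-1) - 1, so one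
    of them has order Q - 1; a power of it has order m. *)
Lemma prim_root_fieldExt (L : fieldExtType F) (m : nat) :
  (0 < m)%N -> (m %| q ^ \dim {:L} - 1)%N -> exists z : L, m.-primitive_root z.
Proof.
move=> m_gt0; rewrite -card_FinFieldExt; set E := FinFieldExtType L => m_dvd.
pose rs := enum (predC1 (0 : E)); have cE := finNzRing_gt1 E.
have : has (#|E| - 1).-primitive_root rs.
  apply: has_prim_root.
  - by rewrite subn_gt0.
  - apply/allP=> x; rewrite mem_enum /= => nz_x; apply/unity_rootP.
    apply: (mulfI nz_x); rewrite -exprS mulr1 subn1 prednK ?(ltnW cE) //.
    exact: expf_card.
  - exact: enum_uniq.
  - by rewrite -cardE cardC1 subn1.
case/hasP=> x _ x_prim; exists (x ^+ ((#|E| - 1) %/ m)).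
exact: dvdn_prim_root.
Qed.

(** The map x -> x^q is additive and multiplicative and fixes F, so it commutes with polynomials
    over F. *)
Lemma horner_in_algX (L : fieldExtType F) (P : {poly F}) (w : L) :
  (map_poly (in_alg L) P).[w ^+ q] = (map_poly (in_alg L) P).[w] ^+ q.
Proof.
have [p p_pr p_char] := finPcharP F.
have pL : p \in [pchar L] by rewrite pchar_lalg.
have q_nat : [pchar L].-nat q.
  by rewrite (eq_pnat _ (pcharf_eq pL)) (card_pprimeChar p_char) pnatX pnat_id.
elim/poly_ind: P => [|P c IHP].
  by rewrite !rmorph0 !horner0 expr0n gtn_eqF // ltnW // finNzRing_gt1.
rewrite rmorphD rmorphM /= map_polyX map_polyC !hornerMXaddC IHP.
by rewrite exprDn_pchar // exprMn -rmorphXn expf_card.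
Qed.

(* w is taken as a root in L of the minimal polynomial of z over F.           *)
Lemma prim_root_transfer (K L : fieldExtType F) (m : nat) (z : K) (w0 : L) :
  m.-primitive_root z -> m.-primitive_root w0 ->
  exists2 w : L, m.-primitive_root w &
    forall P : {poly F}, root (map_poly (in_alg L) P) w ->
      root (map_poly (in_alg K) P) z.
Proof.
move=> z_prim w0_prim; have m_gt0 := prim_order_gt0 z_prim.
have [p Dp] := polyOver1P (minPolyOver 1 z).
have p_dvd (P : {poly F}) : root (map_poly (in_alg K) P) z -> p %| P.
  move=> Pz; rewrite -(dvdp_map (in_alg K)) -Dp minPoly_dvdp //.
  by apply/polyOver1P; exists P.
have mapXn (R : fieldExtType F) k :
    map_poly (in_alg R) ('X^k - 1) = 'X^k - 1.
  by rewrite rmorphB rmorph1 /= map_polyXn.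
have [w pw] : exists w : L, root (map_poly (in_alg L) p) w.
  have := p_dvd ('X^m - 1); rewrite mapXn.
  rewrite /root !hornerE prim_expr_order // subrr eqxx => /(_ isT).
  rewrite -(dvdp_map (in_alg L)) mapXn -(factor_Xn_sub_1 w0_prim).
  case/dvdp_prod_XsubC=> msk Dpw.
  have : size (map_poly (in_alg L) p) != 1%N.
    rewrite size_map_poly -(size_map_poly (in_alg K)) -Dp gtn_eqF //.
    by rewrite (root_size_gt1 _ (root_minPoly _ _)) // monic_neq0 ?monic_minPoly.
  rewrite (eqp_size Dpw).
  case: (mask _ _) Dpw => [|i s] Dpw; first by rewrite big_nil size_poly1.
  exists (w0 ^+ i); have := eqp_root Dpw (w0 ^+ i).
  by rewrite big_cons rootM root_XsubC eqxx; apply.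
have transfer (P : {poly F}) :
    root (map_poly (in_alg L) P) w -> root (map_poly (in_alg K) P) z.
  (* By irreducibility of the minimal polynomial, this gcd is either associate to it, and then P
     vanishes at z, or constant, against the common root w in L. *)
  move=> Pw; have : map_poly (in_alg K) (gcdp p P) %| minPoly 1 z.
    by rewrite Dp dvdp_map dvdp_gcdl.
  case/(minPoly_irr _)/orP; first by apply/polyOver1P; exists (gcdp p P).
    move=> eqg; have := root_minPoly 1 z; rewrite -(eqp_root eqg).
    by rewrite -!dvdp_XsubCl => /dvdp_trans; apply; rewrite dvdp_map dvdp_gcdr.
  rewrite -size_poly_eq1 size_map_poly -(size_map_poly (in_alg L)) gcdp_map.
  by move/coprimep_root/(_ pw)/negPf; rewrite -/(root _ _) Pw.
exists w => //.
(* Transferring X^k - 1 bounds the order of w below by that of z. *)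
have Xw k : w ^+ k = 1 -> z ^+ k = 1.
  move=> wk1; have := transfer ('X^k - 1); rewrite !mapXn /root !hornerE.
  by rewrite wk1 subrr eqxx subr_eq0 => /(_ isT)/eqP.
have wm1 : w ^+ m = 1.
  have : map_poly (in_alg L) p %| 'X^m - 1.
    rewrite -mapXn dvdp_map p_dvd // mapXn /root !hornerE.
    by rewrite prim_expr_order // subrr.
  move: pw; rewrite -dvdp_XsubCl => /dvdp_trans Xdvd /Xdvd.
  by rewrite dvdp_XsubCl /root !hornerE subr_eq0 => /eqP.
have [k w_prim k_dvd] := prim_order_exists m_gt0 wm1.
suff <- : k = m by [].
apply/eqP; rewrite eqn_dvd k_dvd /=; rewrite (prim_order_dvd z_prim).
by rewrite Xw ?prim_expr_order.
Qed.

(** A root z in K is first replaced by a primitive root w of L through [prim_root_transfer]. Over a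
    fixed root z0 of L, the exponent of w lies in some coset of the subgroup generated by q, so w is
    a Frobenius conjugate of the root chosen for that coset. Letting K vary allows all components to
    be compared in a single field. *)
Lemma conjugacy_representatives (L : fieldExtType F) (m : nat) :
  (1 < m)%N -> coprime m q -> \dim {:L} = mult_order m q ->
  exists (S : {set {set {unit 'Z_m}}}) (w : {set {unit 'Z_m}} -> L),
  [/\ #|S| = (totient m %/ mult_order m q)%N,
      forall C, m.-primitive_root (w C)
    & forall P : {poly F},
        (forall C, C \in S -> root (map_poly (in_alg L) P) (w C)) ->
      forall (K : fieldExtType F) (z : K), m.-primitive_root z ->
        root (map_poly (in_alg K) P) z].
Proof.
move=> m_gt1 cmq dimL; have m_gt0 := ltnW m_gt1.
have [z0 z0_prim] : exists z : L, m.-primitive_root z.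
  apply: prim_root_fieldExt => //; rewrite dimL.
  rewrite -eqn_mod_dvd ?expn_gt0 ?(ltnW (finNzRing_gt1 F)) //.
  by rewrite -dvdn_mult_order.
pose Q := <[unit_mod m q]>%g.
pose e (u : {unit 'Z_m}) : nat := val u.
have e_coprime u : coprime (e u) m.
  by rewrite coprime_sym -unitZpE // /e natr_Zp; apply: (valP u).
exists (rcosets Q setT), (fun C => z0 ^+ e (repr C)); split.
- by rewrite totient_div_mult_order.
- by move=> C; rewrite prim_root_exp_coprime.
move=> P HP K z z_prim.
have [w w_prim] := prim_root_transfer z_prim z0_prim; apply.
have [k Dw] := prim_rootP z0_prim (prim_expr_order w_prim).
have kP : coprime m k.
  by rewrite coprime_sym -(prim_root_exp_coprime _ z0_prim) -Dw.
pose C := (Q :* unit_mod m k)%g.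
have SC : C \in rcosets Q setT by apply/rcosetsP; exists (unit_mod m k).
have /rcosetP[x /cycleP[i ->] Dk] : unit_mod m k \in (Q :* repr C)%g.
  by rewrite rcoset_repr rcoset_refl.
have -> : w = (z0 ^+ e (repr C)) ^+ (q ^ i).
  rewrite Dw -exprM; apply/eqP; rewrite (eq_prim_root_expr z0_prim).
  rewrite -!val_Zp_nat // val_eqE natrM natr_Zp -unit_modE // Dk.
  by rewrite unit_modX //= unit_modE ?coprimeXr // mulrC.
elim: i {Dk} => [|i IHi]; first exact: HP.
by rewrite expnSr exprM /root horner_in_algX expf_eq0 (rootP IHi) eqxx andbT
   ltnW ?finNzRing_gt1.
Qed.

End RootsOfUnity.

(** * Normal forms in G and the representations they define *)

(** The modular group of order p^(n+1) has the same presentation, which gives the order of G. The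
    relations bring every element to the form b^k a^i, and there are only p * p^n such products, so
    each element is reached once. *)
Lemma modular_group_normal_form (p n : nat) (gT : finGroupType) :
  prime p -> (2 <= n)%N ->
  ([set: gT] \isog Grp (a : b :
     a ^+ (p ^ n), b ^+ p, a ^ b = a ^+ (p ^ n.-1 + 1)))%g ->
  exists a b : gT,
    [/\ (a ^+ (p ^ n) = 1)%g, (b ^+ p = 1)%g, (a ^ b = a ^+ (p ^ n.-1 + 1))%g
      & bijective (fun x : 'I_p * 'I_(p ^ n) => (b ^+ x.1 * a ^+ x.2)%g)].
Proof.
move=> p_pr n_gt1 isoG.
have oG : #|gT| = (p ^ n.+1)%N.
  have isoM := Grp_modular_group p_pr (n_gt1 : 2 < n.+1)%N.
  rewrite -(card_modular_group p_pr (n_gt1 : 2 < n.+1)%N) -!cardsT.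
  apply: card_isog.
  rewrite isogEhom isoM; have := isoGrp_hom isoG; rewrite addn1 => ->.
  by rewrite isoG addn1 (isoGrp_hom isoM).
have /existsP[[a b] /= /eqP[defG aM bp ab]] := isoGrp_hom isoG.
exists a, b; split=> //.
have p_gt0 := prime_gt0 p_pr.
suff surj : forall x : gT, exists y : 'I_p * 'I_(p ^ n),
    x == (b ^+ y.1 * a ^+ y.2)%g.
  pose g x := xchoose (surj x).
  have gK : cancel g (fun x : 'I_p * 'I_(p ^ n) => (b ^+ x.1 * a ^+ x.2)%g).
    by move=> x; rewrite -(eqP (xchooseP (surj x))).
  apply: (bij_can_bij _ gK); apply: (inj_card_bij (can_inj gK)).
  by rewrite oG card_prod !card_ord expnS.
move=> x; have : (x \in <[b]> * <[a]>)%g.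
  rewrite -norm_joinEl ?norms_cycle ?ab ?mem_cycle // joingC defG inE //.
case/mulsgP=> _ _ /cycleP[k ->] /cycleP[i ->] ->.
rewrite -(expg_mod k bp) -(expg_mod i aM).
have M_gt0 : (0 < p ^ n)%N by rewrite expn_gt0 p_gt0.
by exists (Ordinal (ltn_pmod k p_gt0), Ordinal (ltn_pmod i M_gt0)).
Qed.

Lemma expg_mul_swap (gT : finGroupType) (a b : gT) (c i k : nat) :
  (a ^ b = a ^+ c)%g -> (a ^+ i * b ^+ k = b ^+ k * a ^+ (i * c ^ k))%g.
Proof.
move=> ab; rewrite [LHS]conjgC conjXg mulnC expgM; congr (_ * _ ^+ _)%g.
elim: k => [|k IHk]; first by rewrite conjg1 expg1.
by rewrite expgSr conjgM IHk conjXg ab -expgM expnS.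
Qed.

Lemma expr_mul_swap (R : nzRingType) (A B : R) (c i k : nat) :
  A * B = B * A ^+ c -> A ^+ i * B ^+ k = B ^+ k * A ^+ (i * c ^ k).
Proof.
move=> AB; have swap1 j : A ^+ j * B = B * A ^+ (j * c).
  elim: j => [|j IHj]; first by rewrite mul1r mulr1.
  by rewrite exprS -mulrA IHj mulrA AB -mulrA -exprD mulSn.
elim: k i => [|k IHk] i; first by rewrite mulr1 mul1r muln1.
by rewrite exprSr mulrA IHk -mulrA swap1 mulrA -exprSr expnSr mulnA.
Qed.

(** Words in a, b and in A, B are reordered by the same rule, so b^k a^i -> B^k A^i is
    multiplicative. *)
Lemma normal_form_lift (F : fieldType) (gT : finGroupType) (p M c : nat)
    (a b : gT) (R : algType F) (A B : R) :
  (a ^+ M = 1)%g -> (b ^+ p = 1)%g -> (a ^ b = a ^+ c)%g ->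
  bijective (fun x : 'I_p * 'I_M => (b ^+ x.1 * a ^+ x.2)%g) ->
  A ^+ M = 1 -> B ^+ p = 1 -> A * B = B * A ^+ c ->
  exists f : {lrmorphism group_alg F gT -> R},
    forall u, f u = \sum_(k < p) \sum_(i < M)
      u (b ^+ k * a ^+ i)%g *: (B ^+ k * A ^+ i).
Proof.
move=> aM bp ab [h hK Kh] AM Bp AB.
pose rho x := B ^+ (h x).1 * A ^+ (h x).2.
have rhoE k i : rho (b ^+ k * a ^+ i)%g = B ^+ k * A ^+ i.
  (* The value [h 1] inhabits the index type, so [p] and [M] are positive and exponents can be
     reduced modulo them. *)
  have [x _] : exists x : 'I_p * 'I_M, true by exists (h 1%g).
  have p_gt0 : (0 < p)%N by case: x => x _; apply: leq_ltn_trans (ltn_ord x).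
  have M_gt0 : (0 < M)%N by case: x => _ x; apply: leq_ltn_trans (ltn_ord x).
  rewrite -(expr_mod k Bp) -(expr_mod i AM) -(expg_mod k bp) -(expg_mod i aM).
  pose y := (Ordinal (ltn_pmod k p_gt0), Ordinal (ltn_pmod i M_gt0)).
  by rewrite /rho (hK y).
have [f Ef] : exists f : {lrmorphism group_alg F gT -> R},
    forall u, f u = \sum_x u x *: rho x.
  apply: galg_lift => [|x y].
    by have := rhoE 0%N 0%N; rewrite mulg1 mulr1.
  rewrite -(Kh x) -(Kh y); case: (h x) (h y) => [k i] [k' i'] /=.
  rewrite !rhoE mulgA -(mulgA (b ^+ k)%g) (expg_mul_swap _ _ ab) !mulgA -expgD.
  rewrite -mulgA -expgD rhoE !mulrA -(mulrA (B ^+ k)) (expr_mul_swap _ _ AB).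
  by rewrite mulrA -exprD -mulrA -exprD.
exists f => u; rewrite Ef pair_big.
rewrite (reindex (fun x : 'I_p * 'I_M => (b ^+ x.1 * a ^+ x.2)%g)) /=.
  by apply: eq_bigr => -[k i] _; rewrite rhoE.
by exists h => x _.
Qed.

(** * Fourier inversion *)

Lemma big_nat_mul_split (V : nmodType) (p m : nat) (G : nat -> V) :
  \sum_(i < p * m) G i = \sum_(r < p) \sum_(l < m) G (r + p * l)%N.
Proof.
rewrite exchange_big /=; elim: m => [|m IHm].
  by rewrite muln0 !big_ord0.
rewrite big_ord_recr -IHm -!(big_mkord xpredT G) /= mulnSr.
rewrite (big_cat_nat (leq0n (p * m)) (leq_addr p _)) /=; congr (_ + _).
by rewrite -{1}[(p * m)%N]add0n big_addn addKn big_mkord.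
Qed.

(** A polynomial of degree less than m that vanishes at the m distinct powers of z is zero. *)
Lemma dft_eq0 (K : fieldType) (m : nat) (z : K) (c : nat -> K) :
  m.-primitive_root z ->
  (forall j, \sum_(k < m) c k * (z ^+ j) ^+ k = 0) ->
  forall k, (k < m)%N -> c k = 0.
Proof.
move=> z_prim Hc; pose P := \poly_(k < m) c k.
have Pz x : P.[x] = \sum_(k < m) c k * x ^+ k by apply: horner_poly.
suff P0 : P = 0.
  by move=> k ltkm; have := coef_poly m c k; rewrite -/P P0 coef0 ltkm.
apply: contraTeq (size_poly m c) => nzP; rewrite -ltnNge -/P.
rewrite -{1}(size_iota 0 m) -(size_map (fun j => z ^+ j)).
apply: max_poly_roots => //.
  by apply/allP=> _ /mapP[j _ ->]; rewrite /root Pz Hc.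
rewrite map_inj_in_uniq ?iota_uniq // => i j.
rewrite !mem_iota /= => lti ltj /eqP; rewrite (eq_prim_root_expr z_prim).
by rewrite !modn_small // => /eqP.
Qed.

(** For fixed k and r, the sum over l of c k (r + p l) z^(s l) vanishes for every s ([V0]): the
    linear characters cover s divisible by p, and the matrix entries cover s prime to p, where z^s
    is again primitive. Inversion in l then finishes. *)
Lemma fourier_eq0 (K : fieldType) (p e : nat) (z : K) (c : nat -> nat -> K) :
  prime p -> (p ^ e.+1).-primitive_root z ->
  (forall s t, \sum_(k < p) \sum_(i < p * p ^ e.+1)
      c k i * ((z ^+ (p ^ e * t)) ^+ k * (z ^+ s) ^+ i) = 0) ->
  (forall (w : K) j r, (p ^ e.+1).-primitive_root w -> (r < p)%N ->
     \sum_(k < p) \sum_(l < p ^ e.+1)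
       c k (r + p * l)%N * ((w ^+ (p ^ e * j)) ^+ k * w ^+ l) = 0) ->
  forall k i, (k < p)%N -> (i < p * p ^ e.+1)%N -> c k i = 0.
Proof.
move=> p_pr z_prim Hlin Hmat; set N := (p ^ e.+1)%N in z_prim Hlin Hmat *.
have N_gt0 : (0 < N)%N by rewrite expn_gt0 prime_gt0.
have eta_prim (w : K) : N.-primitive_root w -> p.-primitive_root (w ^+ (p ^ e)).
  move=> w_prim; have -> : (p ^ e = N %/ p)%N.
    by rewrite /N expnS mulKn ?prime_gt0.
  by apply: dvdn_prim_root w_prim _ _; rewrite /N expnS dvdn_mulr.
have nz_z : z != 0.
  by have := oner_neq0 K; rewrite -(prim_expr_order z_prim) expf_eq0 N_gt0.
have V0 k r s : (k < p)%N -> (r < p)%N ->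
    \sum_(l < N) c k (r + p * l)%N * (z ^+ s) ^+ l = 0.
  move=> ltkp ltrp.
  have [/dvdnP[s' ->]|ndvd_ps] := boolP (p %| s)%N.
    have row0 j : \sum_(i < p * N) c k i * (z ^+ j) ^+ i = 0.
      apply: (dft_eq0 (c := fun k => \sum_(i < p * N) c k i * (z ^+ j) ^+ i)
        (eta_prim _ z_prim)) ltkp => t.
      rewrite -[RHS](Hlin j t); apply: eq_bigr => k' _.
      rewrite big_distrl /=; apply: eq_bigr => i _.
      by rewrite exprM mulrAC -mulrA.
    (* All exponents s' + p^e t agree modulo N after multiplication by p, whereas z^((s' + p^e t)
       r') depends on t through (z^(p^e))^(t r'). Varying t therefore separates the residues r'
       modulo p, up to the factor z^(s' r'). *)
    apply: (mulfI (expf_neq0 (s' * r) nz_z)).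
    rewrite mulr0; apply: (dft_eq0 (c := fun r => z ^+ (s' * r) *
      \sum_(l < N) c k (r + p * l)%N * (z ^+ (s' * p)) ^+ l)
      (eta_prim _ z_prim)) ltrp => t.
    rewrite -[RHS](row0 (s' + p ^ e * t)%N).
    rewrite (big_nat_mul_split _ _
      (fun i => c k i * (z ^+ (s' + p ^ e * t)) ^+ i)).
    apply: eq_bigr => r' _.
    rewrite big_distrr big_distrl /=; apply: eq_bigr => l _.
    rewrite mulrCA -mulrA; congr (_ * _); rewrite -!exprM -!exprD.
    have -> : ((s' + p ^ e * t) * (r' + p * l)
        = s' * r' + s' * p * l + p ^ e * t * r' + (p * p ^ e) * (t * l))%N.
      by ring.
    rewrite (exprD _ _ (p * _ * _)) (exprM z (p * _)) -expnS -/N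
      (prim_expr_order z_prim) expr1n mulr1.
    by rewrite !mulnA.
  have w_prim : N.-primitive_root (z ^+ s).
    rewrite prim_root_exp_coprime // coprime_sym coprimeXl //.
    by rewrite prime_coprime.
  apply: (dft_eq0 (c := fun k => \sum_(l < N) c k (r + p * l)%N * (z ^+ s) ^+ l)
    (eta_prim _ w_prim)) ltkp => j.
  rewrite -[RHS](Hmat _ j r w_prim ltrp); apply: eq_bigr => k' _.
  rewrite big_distrl /=; apply: eq_bigr => l _.
  by rewrite exprM mulrAC -mulrA.
move=> k i ltkp ltipN; rewrite (divn_eq i p) addnC mulnC.
have ltr := ltn_pmod i (prime_gt0 p_pr).
have ltl : (i %/ p < N)%N by rewrite ltn_divLR ?prime_gt0 // mulnC.
apply: (dft_eq0 (c := fun l => c k (i %% p + p * l)%N) z_prim) ltl => s.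
exact: V0.
Qed.

(** * Matrix representations *)

(* The i-th power of the companion matrix of X^p - w, acting on row vectors.  *)
Definition root_shift_mx (K : nzRingType) (p : nat) (w : K) (i : nat) :
    'M[K]_p.-1.+1 :=
  \matrix_(j, l) (((j + i) %% p == l)%N%:R * w ^+ ((j + i) %/ p)).

(** Row j stands for T^j modulo T^p - w, where T^(j+i) reduces to w^quotient T^remainder on dividing
    j + i by p. *)
Lemma root_shift_mxM (K : nzRingType) (p : nat) (w : K) (i i' : nat) :
  (0 < p)%N ->
  root_shift_mx p w i * root_shift_mx p w i' = root_shift_mx p w (i + i').
Proof.
move=> p_gt0; apply/matrixP=> j l; rewrite !mxE.
have lt_h : ((j + i) %% p < p.-1.+1)%N.
  by rewrite [X in (_ < X)%N]prednK // ltn_pmod.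
rewrite (bigD1 (Ordinal lt_h)) //= big1 => [|h /negPf nh]; last first.
  by rewrite !mxE eq_sym -val_eqE /= in nh *; rewrite nh !mul0r.
rewrite !mxE /= eqxx mul1r addr0 modnDml addnA.
have [Dl|] := eqVneq; rewrite ?mul1r ?mul0r ?mulr0 // -exprD.
congr (_ ^+ _); by rewrite [in RHS](divn_eq (j + i) p) -addnA divnMDl.
Qed.

Lemma root_shift_mx0 (K : nzRingType) (p : nat) (w : K) :
  (0 < p)%N -> root_shift_mx p w 0 = 1.
Proof.
move=> p_gt0; apply/matrixP=> j l; rewrite !mxE addn0.
have ltjp : (j < p)%N by have := ltn_ord j; rewrite [X in (_ < X)%N]prednK.
by rewrite modn_small // divn_small // mulr1.
Qed.

Lemma root_shift_mxX (K : nzRingType) (p : nat) (w : K) (i : nat) :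
  (0 < p)%N -> root_shift_mx p w 1 ^+ i = root_shift_mx p w i.
Proof.
move=> p_gt0; elim: i => [|i IHi]; first by rewrite root_shift_mx0.
by rewrite exprS IHi root_shift_mxM.
Qed.

Lemma root_shift_mx_dvd (K : nzRingType) (p : nat) (w : K) (i : nat) :
  (0 < p)%N -> root_shift_mx p w (p * i) = (w ^+ i)%:M.
Proof.
move=> p_gt0; apply/matrixP=> j l; rewrite !mxE.
have ltjp : (j < p)%N by have := ltn_ord j; rewrite [X in (_ < X)%N]prednK.
rewrite mulnC addnC modnMDl divnMDl // modn_small // divn_small //.
by rewrite addn0 mulr_natl.
Qed.

Lemma diag_mxX (K : comNzRingType) (m : nat) (d : 'rV[K]_m.+1) (k : nat) :
  diag_mx d ^+ k = diag_mx (map_mx (fun x => x ^+ k) d).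
Proof.
elim: k => [|k IHk]; last first.
  rewrite exprS IHk -mulmxE mul_diag_mx; apply/matrixP=> i j; rewrite !mxE.
  by rewrite exprS mulrnAr.
by apply/matrixP=> i j; rewrite !mxE.
Qed.

Lemma mat_algZE (F : fieldType) (L : fieldExtType F) (p : nat) (c : F)
    (A : mat_alg L p) (i j : 'I_p.-1.+1) :
  (c *: A : 'M[L]_p.-1.+1) i j = c *: (A : 'M[L]_p.-1.+1) i j.
Proof. by rewrite [LHS]mxE mulr_algl. Qed.

(** Put eta = w^e, so that eta^p = 1. As N = p e, the matrix A^N is the scalar eta, and the
    commutation relation becomes A B = eta B A, which the diagonal matrix B of powers of eta
    satisfies. Only the b^k a^i with i = r modulo p contribute to entry (j, j + r), indices modulo
    p; that entry yields the sum. *)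
Lemma matrix_lift (F : fieldType) (gT : finGroupType) (p N e : nat)
    (a b : gT) (K : fieldExtType F) (w : K) :
  (0 < p)%N ->
  (a ^+ (p * N) = 1)%g -> (b ^+ p = 1)%g -> (a ^ b = a ^+ (N + 1))%g ->
  bijective (fun x : 'I_p * 'I_(p * N) => (b ^+ x.1 * a ^+ x.2)%g) ->
  N = (p * e)%N -> w ^+ N = 1 ->
  exists f : {lrmorphism group_alg F gT -> mat_alg K p},
    forall u, f u = 0 -> forall (j r : nat), (r < p)%N ->
      \sum_(k < p) \sum_(l < N)
        (u (b ^+ k * a ^+ (r + p * l))%g)%:A * ((w ^+ (e * j)) ^+ k * w ^+ l)
      = 0.
Proof.
move=> p_gt0 aM bp ab bij_ab DN wN.
pose A : mat_alg K p := root_shift_mx p w 1.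
pose B : mat_alg K p := diag_mx (\row_(j < p.-1.+1) (w ^+ e) ^+ j).
have AE i : A ^+ i = root_shift_mx p w i by exact: root_shift_mxX.
have BE k : B ^+ k = diag_mx (\row_(j < p.-1.+1) ((w ^+ e) ^+ j) ^+ k).
  by rewrite [LHS]diag_mxX; congr diag_mx; apply/rowP=> j; rewrite !mxE.
have etap : (w ^+ e) ^+ p = 1 by rewrite -exprM mulnC -DN.
have [f Df] : exists f : {lrmorphism group_alg F gT -> mat_alg K p},
    forall u, f u = \sum_(k < p) \sum_(i < p * N)
      u (b ^+ k * a ^+ i)%g *: (B ^+ k * A ^+ i).
  apply: normal_form_lift aM bp ab bij_ab _ _ _.
  - by rewrite AE root_shift_mx_dvd // wN.
  - rewrite BE; apply/matrixP=> i j; rewrite !mxE.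
    by rewrite exprAC etap expr1n.
  - rewrite AE.
    change ((A : 'M[K]_p.-1.+1) *m B = B *m root_shift_mx p w (N + 1)).
    rewrite mul_mx_diag mul_diag_mx; apply/matrixP=> i j; rewrite !mxE.
    have -> : (i + (N + 1) = e * p + (i + 1))%N by rewrite DN; ring.
    rewrite modnMDl divnMDl // exprD.
    have [<-|] := eqVneq; rewrite ?mul1r ?mul0r ?mulr0 //.
    rewrite (expr_mod _ etap) addn1 exprS; ring.
exists f => u; rewrite Df => fu0 j r ltrp.
have lt_p h : (h %% p < p.-1.+1)%N by rewrite [X in (_ < X)%N]prednK ?ltn_pmod.
have /matrixP/(_ (Ordinal (lt_p j)) (Ordinal (lt_p (j + r)%N))) := fu0.
rewrite [RHS]mxE summxE => entry0; set j0 := (j %% p)%N in entry0.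
have nz_w : w != 0.
  have N_gt0 : (0 < p * N)%N.
    have [h _ _] := bij_ab; case: (h 1%g) => _ i.
    exact: leq_ltn_trans (ltn_ord i).
  have := oner_neq0 K; rewrite -wN expf_eq0 => /nandP[|//].
  by rewrite -leqNgt leqn0 => /eqP N0; rewrite N0 muln0 in N_gt0.
(* In this entry a^(r + p l) contributes [w] to the power l + (j0 + r) %/ p; the part independent of
   l is cancelled. *)
apply: (mulfI (expf_neq0 ((j0 + r) %/ p) nz_w)).
rewrite mulr0 -[RHS]entry0 big_distrr; apply: eq_bigr => k _ /=.
pose G i := u (b ^+ k * a ^+ i)%g *:
  (((w ^+ e) ^+ j0) ^+ k *
    (((j0 + i) %% p == (j + r) %% p)%N%:R * w ^+ ((j0 + i) %/ p))).
rewrite summxE -[RHS]/(\sum_(i < p * N) _).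
rewrite (eq_bigr (fun i : 'I_(p * N) => G i)); last first.
  move=> i _; rewrite mat_algZE AE BE /G; congr (_ *: _).
  by rewrite -mulmxE mul_diag_mx !mxE.
have split_i r' l : (j0 + (r' + p * l) = l * p + (j0 + r'))%N by ring.
rewrite (big_nat_mul_split _ _ G) (bigD1 (Ordinal ltrp)) //= [X in _ + X]big1.
  rewrite addr0 big_distrr; apply: eq_bigr => l _ /=; rewrite /G.
  rewrite split_i modnMDl divnMDl // modnDml eqxx mul1r exprM.
  rewrite /j0 (expr_mod _ etap) mulr_algl -scalerAr exprD.
  by congr (_ *: _); ring.
move=> r' /negPf nr; apply: big1 => l _; rewrite /G split_i modnMDl modnDml.
rewrite eqn_modDl !modn_small // -[r]/(val (Ordinal ltrp)) val_eqE nr.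
by rewrite mul0r mulr0 scaler0.
Qed.

(** * Linear characters *)

Lemma character_lift (F : fieldType) (gT : finGroupType) (p M N : nat)
    (a b : gT) (E : fieldExtType F) (x y : E) :
  (a ^+ M = 1)%g -> (b ^+ p = 1)%g -> (a ^ b = a ^+ (N + 1))%g ->
  bijective (fun x : 'I_p * 'I_M => (b ^+ x.1 * a ^+ x.2)%g) ->
  (N %| M)%N -> x ^+ N = 1 -> y ^+ p = 1 ->
  exists f : {lrmorphism group_alg F gT -> E},
    forall u, f u = \sum_(k < p) \sum_(i < M)
      u (b ^+ k * a ^+ i)%g *: (y ^+ k * x ^+ i).
Proof.
move=> aM bp ab bij_ab /dvdnP[d DM] xN yp.
apply: normal_form_lift aM bp ab bij_ab _ yp _.
  by rewrite DM mulnC exprM xN expr1n.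
by rewrite addn1 exprS xN mulr1 mulrC.
Qed.

(** For each t, the character a -> z^(e1 t), b -> z^(e2 t) takes at u the value at z of a polynomial
    over F, so one z per Frobenius orbit controls all primitive m-th roots. *)
Lemma detects_characters (F : finFieldType) (gT : finGroupType) (p M N m : nat)
    (a b : gT) (E : fieldExtType F) (T : finType) (e1 e2 : T -> nat) :
  (a ^+ M = 1)%g -> (b ^+ p = 1)%g -> (a ^ b = a ^+ (N + 1))%g ->
  bijective (fun x : 'I_p * 'I_M => (b ^+ x.1 * a ^+ x.2)%g) ->
  (N %| M)%N -> (1 < m)%N -> coprime m #|F| ->
  \dim {:E} = mult_order m #|F| ->
  (forall t, (m %| e1 t * N)%N) -> (forall t, (m %| e2 t * p)%N) ->
  detects (copies (#|T| * totient m %/ mult_order m #|F|) E)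
    (fun u : group_alg F gT => forall (t : T) (K : fieldExtType F) (z : K),
       m.-primitive_root z ->
       \sum_(k < p) \sum_(i < M)
         (u (b ^+ k * a ^+ i)%g)%:A * ((z ^+ e2 t) ^+ k * (z ^+ e1 t) ^+ i)
       = 0).
Proof.
move=> aM bp ab bij_ab NM m_gt1 cmq dimE e1P e2P.
have [S [w [cardS w_prim Pz]]] := conjugacy_representatives m_gt1 cmq dimE.
have /fin_all_exists[f Df] (x : T * {set {unit 'Z_m}}) :
    exists f : {lrmorphism group_alg F gT -> E},
    forall u, f u = \sum_(k < p) \sum_(i < M) u (b ^+ k * a ^+ i)%g *:
      ((w x.2 ^+ e2 x.1) ^+ k * (w x.2 ^+ e1 x.1) ^+ i).
  apply: character_lift aM bp ab bij_ab NM _ _; rewrite -exprM; apply/eqP.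
    by rewrite -(prim_order_dvd (w_prim _)).
  by rewrite -(prim_order_dvd (w_prim _)).
rewrite -muln_divA ?mult_order_dvd_totient // -cardS -cardsT -cardsX.
apply: detects_weaken (detects_copies _ f) => u fu0 t K z z_prim.
pose P : {poly F} := \sum_(k < p) \sum_(i < M)
  u (b ^+ k * a ^+ i)%g *: 'X^(e2 t * k + e1 t * i).
have PE (R : fieldExtType F) (x : R) : (map_poly (in_alg R) P).[x] =
    \sum_(k < p) \sum_(i < M)
      (u (b ^+ k * a ^+ i)%g)%:A * ((x ^+ e2 t) ^+ k * (x ^+ e1 t) ^+ i).
  rewrite rmorph_sum horner_sum; apply: eq_bigr => k _ /=.
  rewrite rmorph_sum horner_sum; apply: eq_bigr => i _ /=.
  by rewrite map_polyZ map_polyXn hornerZ hornerXn exprD !exprM.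
rewrite -PE; apply/rootP/Pz => // C SC; apply/rootP; rewrite PE.
have := fu0 (t, C); rewrite inE in_setT SC Df => /(_ isT) fu0tC.
rewrite -[RHS]fu0tC.
by apply: eq_bigr => k _; apply: eq_bigr => i _; rewrite mulr_algl.
Qed.

(** * Orders of q modulo successive powers of p *)

Lemma totient_pfactorS (p e : nat) :
  prime p -> (totient (p ^ e.+2) = p * totient (p ^ e.+1))%N.
Proof. by move=> p_pr; rewrite !totient_pfactor //= expnS mulnCA. Qed.

(** The binomial expansion modulo N^2. *)
Lemma expn_1add (N s r : nat) :
  exists t, ((1 + N * s) ^ r = 1 + r * (N * s) + N * N * t)%N.
Proof.
elim: r => [|r [t IHr]]; first by exists 0%N; rewrite muln0.
exists (r * s * s + t + N * s * t)%N; rewrite expnS IHr mulSn; ring.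
Qed.

Section MultOrderPrimePower.

Variables (p e q : nat).
Hypotheses (p_pr : prime p) (cpq : coprime p q).
Local Notation N := (p ^ e.+1)%N.
Local Notation M := (p ^ e.+2)%N.

Let p_gt0 : (0 < p)%N := prime_gt0 p_pr.
Let N_gt1 : (1 < N)%N.
Proof. by rewrite -(exp1n e.+1) ltn_exp2r ?prime_gt1. Qed.
Let M_gt1 : (1 < M)%N.
Proof. by rewrite -(exp1n e.+2) ltn_exp2r ?prime_gt1. Qed.
Let cNq : coprime N q. Proof. by rewrite coprimeXl. Qed.
Let cMq : coprime M q. Proof. by rewrite coprimeXl. Qed.
Let cM1N : coprime M (1 + N).
Proof.
rewrite coprimeXl // prime_coprime // expnS dvdn_addl ?dvdn_mulr //.
by rewrite dvdn1 gtn_eqF ?prime_gt1.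
Qed.

Let q_gt0 : (0 < q)%N.
Proof.
rewrite lt0n; apply: contraTneq cpq => ->.
by rewrite /coprime gcdn0 gtn_eqF ?prime_gt1.
Qed.
Let eq1_dvd m i : (q ^ i == 1 %[mod m])%N = (m %| q ^ i - 1)%N.
Proof. by rewrite eqn_mod_dvd // expn_gt0 q_gt0. Qed.

(** If q^i = 1 + N s, its p-th power is 1 modulo M = p N, since M also divides N^2. Hence the
    quotient d of the two orders divides p. *)
Lemma mult_order_p_tower :
  exists2 d, mult_order M q = (mult_order N q * d)%N & (d == 1%N) || (d == p)
    && ~~ (M %| q ^ mult_order N q - 1)%N.
Proof.
have dvd_NM : (mult_order N q %| mult_order M q)%N.
  rewrite dvdn_mult_order // eq1_dvd //.
  apply: (@dvdn_trans M); first exact: dvdn_exp2l.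
  by rewrite -eq1_dvd // -dvdn_mult_order ?dvdnn.
have dvd_Mp : (mult_order M q %| mult_order N q * p)%N.
  have /dvdnP[s Ds] : (N %| q ^ mult_order N q - 1)%N.
    by rewrite -eq1_dvd // -dvdn_mult_order ?dvdnn.
  rewrite dvdn_mult_order // eq1_dvd // expnM.
  rewrite -(subnKC (_ : 0 < q ^ _)%N) ?expn_gt0 ?q_gt0 //.
  rewrite Ds [(s * N)%N]mulnC; have [t ->] := expn_1add N s p.
  rewrite -addnA addKn; apply: dvdn_add.
    by rewrite mulnA -expnS dvdn_mulr.
  by rewrite dvdn_mulr // -expnD dvdn_exp2l //; lia.
have o_gt0 : (0 < mult_order N q)%N by rewrite order_gt0.
case/dvdnP: dvd_NM => d Dd; exists d; first by rewrite mulnC.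
move: dvd_Mp; rewrite Dd mulnC dvdn_pmul2l // => d_dvd.
case/primeP: (p_pr) => _ /(_ d d_dvd)/orP[->//|/eqP Dp].
rewrite Dp eqxx /= orbC.
rewrite -eq1_dvd // -dvdn_mult_order // Dd Dp; apply/orP; left.
apply: contraL (prime_gt1 p_pr) => /dvdn_leq; rewrite o_gt0 => /(_ isT).
by rewrite -{2}[mult_order N q]mul1n leq_pmul2r // -leqNgt.
Qed.

(** If q^i = 1 + N modulo M, then i is a multiple of the order modulo N although q^i is not 1 modulo
    M, so the two orders differ. *)
Lemma mult_order_mem :
  unit_mod M (1 + N) \in <[unit_mod M q]>%g ->
  mult_order M q = (p * mult_order N q)%N.
Proof.
case/cycleP=> i; rewrite unit_modX // => /eqP.
rewrite eq_unit_mod ?coprimeXr // => Di.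
have [d oM /orP[/eqP d1|/andP[/eqP Dd _]]] := mult_order_p_tower; last first.
  by rewrite oM Dd mulnC.
have : (mult_order N q %| i)%N.
  rewrite dvdn_mult_order // -(modn_dvdm (q ^ i) (_ : N %| M)%N) ?dvdn_exp2l //.
  by rewrite -(eqP Di) modn_dvdm ?dvdn_exp2l // addnC modnDl.
rewrite -[mult_order N q]muln1 -d1 -oM dvdn_mult_order // -(eqP Di).
by rewrite eqn_mod_dvd ?leq_addr // addKn dvdn_Pexp2l ?prime_gt1 // ltnn.
Qed.

(** If the orders differed, q to its order modulo N would be 1 + N s with s prime to p, and its r-th
    power, r being an inverse of s modulo p, would be 1 + N modulo M. *)
Lemma mult_order_notin :
  unit_mod M (1 + N) \notin <[unit_mod M q]>%g ->
  mult_order M q = mult_order N q.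
Proof.
have [d -> /orP[/eqP->|/andP[_ notM]]] := mult_order_p_tower.
  by rewrite muln1.
case/negP.
have /dvdnP[s Ds] : (N %| q ^ mult_order N q - 1)%N.
  by rewrite -eq1_dvd // -dvdn_mult_order ?dvdnn.
have cps : coprime s p.
  rewrite coprime_sym prime_coprime //; apply: contra notM => /dvdnP[s' Ds'].
  by rewrite Ds Ds' -mulnA -expnS dvdn_mull.
have s_gt0 : (0 < s)%N.
  by rewrite lt0n; apply: contraNneq notM => s0; rewrite Ds s0 mul0n dvdn0.
have [[r h] /= Drh] := coprimeP _ s_gt0 cps.
apply/cycleP; exists (mult_order N q * r)%N; apply/eqP.
rewrite unit_modX // eq_unit_mod ?coprimeXr // expnM.
rewrite -(subnKC (_ : 0 < q ^ _)%N) ?expn_gt0 ?q_gt0 //.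
rewrite Ds [(s * N)%N]mulnC; have [t ->] := expn_1add N s r.
have -> : (r * (N * s) = N + M * h)%N.
  have -> : (r * (N * s) = N * (1 + h * p))%N.
    by rewrite mulnCA; congr (_ * _)%N; lia.
  by rewrite (expnS p e.+1); ring.
have -> : (1 + (N + M * h) + N * N * t = M * (h + p ^ e * t) + (1 + N))%N.
  by rewrite !(expnS p); ring.
by rewrite [(M * _)%N]mulnC modnMDl.
Qed.

End MultOrderPrimePower.

(** * Assembling the decomposition *)

Lemma detects_matrices (F : finFieldType) (gT : finGroupType) (p N e : nat)
    (a b : gT) (K : fieldExtType F) :
  (0 < p)%N -> (1 < N)%N -> N = (p * e)%N ->
  (a ^+ (p * N) = 1)%g -> (b ^+ p = 1)%g -> (a ^ b = a ^+ (N + 1))%g ->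
  bijective (fun x : 'I_p * 'I_(p * N) => (b ^+ x.1 * a ^+ x.2)%g) ->
  coprime N #|F| -> \dim {:K} = mult_order N #|F| ->
  detects (copies (totient N %/ mult_order N #|F|) (mat_alg K p))
    (fun u : group_alg F gT => forall (w : K) (j r : nat),
       N.-primitive_root w -> (r < p)%N ->
       \sum_(k < p) \sum_(l < N)
         (u (b ^+ k * a ^+ (r + p * l))%g)%:A * ((w ^+ (e * j)) ^+ k * w ^+ l)
       = 0).
Proof.
move=> p_gt0 N_gt1 DN aM bp ab bij_ab cNq dimK.
have [S [w [cardS w_prim Pz]]] := conjugacy_representatives N_gt1 cNq dimK.
have /fin_all_exists[f f0] C :=
  matrix_lift p_gt0 aM bp ab bij_ab DN (prim_expr_order (w_prim C)).
rewrite -cardS; apply: detects_weaken (detects_copies _ f).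
move=> u fu0 z j r z_prim ltrp.
pose P : {poly F} := \sum_(k < p) \sum_(l < N)
  u (b ^+ k * a ^+ (r + p * l))%g *: 'X^(e * j * k + l).
have PE (x : K) : (map_poly (in_alg K) P).[x] = \sum_(k < p) \sum_(l < N)
    (u (b ^+ k * a ^+ (r + p * l))%g)%:A * ((x ^+ (e * j)) ^+ k * x ^+ l).
  rewrite rmorph_sum horner_sum; apply: eq_bigr => k _ /=.
  rewrite rmorph_sum horner_sum; apply: eq_bigr => l _ /=.
  by rewrite map_polyZ map_polyXn hornerZ hornerXn exprD !exprM.
by rewrite -PE; apply/rootP/Pz => // C SC; apply/rootP; rewrite PE f0 ?fu0.
Qed.

Lemma has_card_copies_totient (F : finFieldType) (L : fieldExtType F)
    (k m : nat) :
  (1 < m)%N -> \dim {:L} = mult_order m #|F| ->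
  has_card (prod_all (copies (k * totient m %/ mult_order m #|F|) L))
    (#|F| ^ (k * totient m)).
Proof.
move=> m_gt1 dimL; have := has_card_copies
  (k * totient m %/ mult_order m #|F|) (has_card_fieldExt L : has_card _ _).
rewrite -expnM dimL [(mult_order _ _ * _)%N]mulnC divnK //.
by rewrite dvdn_mull ?mult_order_dvd_totient.
Qed.

(** The dimension of the commutative part, which is the order of the abelianization of G for n = e +
    2. *)
Lemma sum_totient_pfactor (p e : nat) : prime p ->
  (1 + (totient p + \sum_(j <- index_iota 1 e.+2) p * totient (p ^ j))
   = p ^ e.+2)%N.
Proof.
move=> p_pr; have p_gt0 := prime_gt0 p_pr.
elim: e => [|e IHe].
  by rewrite big_nat1 expn1 totient_prime // expnS expn1; nia.
rewrite big_nat_recr //= [X in (_ + X)%N]addnA addnA IHe totient_pfactor //=.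
by rewrite mulnCA -expnS -mulSn prednK // -expnS.
Qed.

(** Here n = e + 2. Counting the matrix blocks by primitive roots of order p^(e+1), and not p^n,
    gives a form that covers both cases of the theorem at once. *)
Lemma group_alg_decomposition (p e : nat) (gT : finGroupType)
    (F : finFieldType) (L : nat -> fieldExtType F) :
  prime p ->
  ([set: gT] \isog Grp (a : b :
     a ^+ (p ^ e.+2), b ^+ p, a ^ b = a ^+ (p ^ e.+1 + 1)))%g ->
  coprime #|F| p ->
  (forall d : nat, (0 < d)%N -> \dim {: L d} = d) ->
  let o (m : nat) : nat := mult_order m #|F| in
  alg_iso (group_alg F gT)
    (direct_sum F^o
      ((copies (totient p %/ o p) (L (o p)) ++
        flatten [seq copies (p * totient (p ^ j) %/ o (p ^ j)%N)
                      (L (o (p ^ j)%N)) | j <- index_iota 1 e.+2]) ++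
       copies (totient (p ^ e.+1) %/ o (p ^ e.+1)%N)
         (mat_alg (L (o (p ^ e.+1)%N)) p))).
Proof.
move=> p_pr isoG cqp dimL o; have p_gt0 := prime_gt0 p_pr.
have p_gt1 := prime_gt1 p_pr.
have pe_gt1 j : (0 < j)%N -> (1 < p ^ j)%N.
  by move=> j_gt0; rewrite -(exp1n j) ltn_exp2r.
have c_pe j : coprime (p ^ j) #|F| by rewrite coprimeXl // coprime_sym.
have dimLo m : \dim {: L (o m)} = o m by rewrite dimL // order_gt0.
have [a [b [aM bp ab bij_ab]]] :=
  modular_group_normal_form p_pr (isT : 2 <= e.+2)%N isoG.
rewrite /= in ab; have dvdNM : (p ^ e.+1 %| p ^ e.+2)%N by rewrite dvdn_exp2l.
have [f0 f0E] : exists f : {lrmorphism group_alg F gT -> F^o},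
    forall u, f u = \sum_(k < p) \sum_(i < p ^ e.+2)
      u (b ^+ k * a ^+ i)%g *: (1 ^+ k * 1 ^+ i).
  by apply: normal_form_lift aM bp ab bij_ab _ _ _; rewrite ?expr1n ?mulr1.
(* Characters trivial on a that send b to a primitive p-th root of unity. *)
have D1 := @detects_characters F gT p _ _ p a b (L (o p)) unit (fun=> 0%N)
  (fun=> 1%N) aM bp ab bij_ab dvdNM p_gt1 (c_pe 1%N) (dimLo p)
  (fun=> dvdn0 p) (fun=> dvdn_mull 1 (dvdnn p)).
rewrite card_unit mul1n in D1.
(* Characters sending a to a primitive p^j-th root z; the p values of t make b run over all p-th
   roots of unity, as powers of z^(p^(j-1)). *)
have D2 j : j \in index_iota 1 e.+2 ->
    detects (copies (p * totient (p ^ j) %/ o (p ^ j)%N) (L (o (p ^ j)%N)))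
      (fun u : group_alg F gT => forall (t : 'I_p) (K : fieldExtType F) (z : K),
         (p ^ j).-primitive_root z ->
         \sum_(k < p) \sum_(i < p ^ e.+2) (u (b ^+ k * a ^+ i)%g)%:A *
            ((z ^+ (p ^ j.-1 * t)) ^+ k * (z ^+ 1) ^+ i) = 0).
  rewrite mem_index_iota => /andP[j_gt0 j_le].
  rewrite -{1}[p]card_ord; apply: (detects_characters (e1 := fun=> 1%N)
    aM bp ab bij_ab dvdNM (pe_gt1 j j_gt0) (c_pe j) (dimLo _)) => t.
    by rewrite mul1n dvdn_exp2l.
  by rewrite mulnAC -expnSr prednK // dvdn_mulr.
have D3 := detects_matrices p_gt0 (pe_gt1 _ (ltn0Sn e)) (expnS p e)
  (aM : a ^+ (p * p ^ e.+1) = 1)%g bp ab bij_ab (c_pe _) (dimLo _).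
have D := detects_cat (detects_cat D1 (detects_flatten D2)) D3.
have [f fE] := detects_direct_sum f0 D.
suff f_inj : injective f.
  exists f; apply: has_card_inj_bij (has_card_group_alg F gT) _ f_inj.
  have oG : #|gT| = (p * p ^ e.+2)%N.
    by rewrite -(bij_eq_card bij_ab) card_prod !card_ord.
  have dim_eq : (p * p ^ e.+2 = 1 + (1 * totient p +
      \sum_(j <- index_iota 1 e.+2) p * totient (p ^ j)
      + totient (p ^ e.+1) * p ^ 2))%N.
    rewrite mul1n addnA sum_totient_pfactor // totient_pfactor //=.
    by rewrite -mulnA -expnD addn2 -mulSn prednK.
  rewrite oG dim_eq expnD expn1.
  have [h /has_card_bij Dh] := direct_sum_bij F^o
    ((copies (totient p %/ o p) (L (o p)) ++
        flatten [seq copies (p * totient (p ^ j) %/ o (p ^ j)%N)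
                      (L (o (p ^ j)%N)) | j <- index_iota 1 e.+2]) ++
       copies (totient (p ^ e.+1) %/ o (p ^ e.+1)%N)
         (mat_alg (L (o (p ^ e.+1)%N)) p)).
  apply: Dh; apply: has_card_prod.
    by exists F, id; split; first exists id.
  rewrite 2!expnD; apply: has_card_cat; first apply: has_card_cat.
  - by have := has_card_copies_totient 1 p_gt1 (dimLo p); rewrite mul1n.
  - apply: has_card_flatten => j; rewrite mem_index_iota => /andP[j_gt0 _].
    exact: has_card_copies_totient (pe_gt1 j j_gt0) (dimLo _).
  - have := has_card_copies (totient (p ^ e.+1) %/ o (p ^ e.+1)%N)
      (has_card_mat_alg (L (o (p ^ e.+1)%N)) p_gt0).
    rewrite -expnM dimLo mulnAC [(o _ * _)%N]mulnC divnK //.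
    exact: mult_order_dvd_totient (pe_gt1 _ (ltn0Sn e)).
apply: raddf_inj => u /fE[f0u0 [[u1 u2] u3]].
set K := L (o (p ^ e.+1)%N) in D3 u3.
have [z z_prim] : exists z : K, (p ^ e.+1).-primitive_root z.
  apply: prim_root_fieldExt; rewrite ?expn_gt0 ?p_gt0 // dimLo.
  rewrite -eqn_mod_dvd ?expn_gt0 ?(ltnW (finNzRing_gt1 F)) //.
  by rewrite -dvdn_mult_order ?pe_gt1.
have prim_p (x : K) : x ^+ p = 1 -> x != 1 -> p.-primitive_root x.
  move=> xp nx1; have [m x_prim] := prim_order_exists p_gt0 xp.
  case/primeP: (p_pr) => _ /[apply] /orP[/eqP m1|/eqP <- //].
  by case/eqP: nx1; have := prim_expr_order x_prim; rewrite m1.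
suff c0 : forall k i, (k < p)%N -> (i < p * p ^ e.+1)%N ->
    (u (b ^+ k * a ^+ i)%g)%:A = 0 :> K.
  have [h _ hK] := bij_ab; apply/ffunP=> x; rewrite ffunE -(hK x).
  apply/eqP; have /eqP := c0 _ _ (ltn_ord (h x).1) (ltn_ord (h x).2).
  by rewrite scaler_eq0 oner_eq0 orbF.
apply: (fourier_eq0 (c := fun k i => (u (b ^+ k * a ^+ i)%g)%:A)
  p_pr z_prim); last first.
  by move=> w j r w_prim ltrp; apply: u3.
move=> s t; set y := z ^+ (p ^ e * t); set x := z ^+ s.
have yp : y ^+ p = 1.
  by rewrite -exprM mulnAC -expnSr exprM (prim_expr_order z_prim) expr1n.
have xN : x ^+ (p ^ e.+1) = 1.
  by rewrite exprAC (prim_expr_order z_prim) expr1n.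
(* The order of x decides which summand handles the character (x, y): for order 1 it is [f0] when y
   = 1 and [u1] otherwise; for order p^(j+1) it is [u2], as y is then a power of x^(p^j). *)
have [m x_prim] := prim_order_exists (ltnW (pe_gt1 _ (ltn0Sn e))) xN.
case/(dvdn_pfactor _ _ p_pr)=> [[|j] le_j Dm].
  have -> : x = 1 by have := prim_expr_order x_prim; rewrite Dm.
  have [->|ny1] := eqVneq y 1; last first.
    by rewrite -[RHS](u1 tt K y (prim_p y yp ny1)).
  transitivity (in_alg K (f0 u : F)); last by rewrite f0u0 rmorph0.
  rewrite f0E rmorph_sum.
  apply: eq_bigr => k _; rewrite rmorph_sum; apply: eq_bigr => i _ /=.
  by rewrite !expr1n !mulr1; congr (_%:A); rewrite [RHS]mulr1.
have [k0 Dy] : exists k0 : 'I_p, y = (x ^+ (p ^ j)) ^+ k0.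
  have xp_prim : p.-primitive_root (x ^+ (p ^ j)).
    have -> : (p ^ j = m %/ p)%N by rewrite Dm expnS mulKn.
    by apply: dvdn_prim_root x_prim _ _; rewrite Dm expnS dvdn_mulr.
  by have [k0 ->] := prim_rootP xp_prim yp; exists k0.
rewrite Dm in x_prim; have := u2 j.+1; rewrite mem_index_iota /= ltnS.
by move=> /(_ le_j k0 K x x_prim) u2x; rewrite -[RHS]u2x Dy -exprM.
Qed.

Theorem corollary4p2 (p n q : nat) (gT : finGroupType) (F : finFieldType)
    (L : nat -> fieldExtType F) :
  prime p -> odd p -> (2 <= n)%N ->
  ([set: gT] \isog Grp (a : b :
     a ^+ (p ^ n), b ^+ p, a ^ b = a ^+ (p ^ n.-1 + 1)))%g ->
  #|F| = q -> coprime q p ->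
  (forall d : nat, (0 < d)%N -> \dim {: L d} = d) ->
  let o (m : nat) : nat := mult_order m q in
  let commutative_part : seq (algType F) :=
    copies (totient p %/ o p) (L (o p)) ++
    flatten [seq copies (p * totient (p ^ j) %/ o (p ^ j)%N)
                      (L (o (p ^ j)%N))
            | j <- index_iota 1 n] in
  (unit_mod (p ^ n) (1 + p ^ n.-1) \in <[unit_mod (p ^ n) q]>%g ->
     alg_iso (group_alg F gT)
       (direct_sum F^o
         (commutative_part ++
          copies (totient (p ^ n) %/ o (p ^ n)%N)
               (mat_alg (L (o (p ^ n)%N %/ p)%N) p))))
  /\
  (unit_mod (p ^ n) (1 + p ^ n.-1) \notin <[unit_mod (p ^ n) q]>%g ->
     alg_iso (group_alg F gT)
       (direct_sum F^o
         (commutative_part ++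
          copies (totient (p ^ n) %/ (p * o (p ^ n)%N))
               (mat_alg (L (o (p ^ n)%N)) p)))).
Proof.
move=> p_pr _; case: n => [//|[//|e]] _ isoG <- cqp dimL o commutative_part.
have cpq : coprime p #|F| by rewrite coprime_sym.
have := group_alg_decomposition p_pr isoG cqp dimL.
rewrite /= -/(o _) -/commutative_part => iso.
have p_gt0 := prime_gt0 p_pr.
split=> [/(mult_order_mem p_pr cpq)|/(mult_order_notin p_pr cpq)] oM.
  have -> : (o (p ^ e.+2) %/ p = o (p ^ e.+1))%N by rewrite /o oM mulKn.
  by rewrite /o oM totient_pfactorS // divnMl.
by rewrite /o oM totient_pfactorS // divnMl.
Qed.
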